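(* Let $(R,\mathfrak{m})$ be a Noetherian local ring, let $cl$ be a Nakayama closure on ideals of $R$, and let $J$ be a $cl$-reduction of an ideal $I$ of $R$. Then $J$ is a minimal $cl$-reduction of $I$ if and only if $J$ is a strongly $cl$-independent ideal.
   Context: A closure operation $cl$ on ideals of $R$ assigns to each ideal $I$ an ideal $I^{cl}$ such that $I\subseteq I^{cl}=(I^{cl})^{cl}$, and such that $J\subseteq I$ implies $J^{cl}\subseteq I^{cl}$ for all ideals $I,J$. It is a Nakayama closure if for any ideals $I$ and $J$ such that $J\subseteq I\subseteq(J+\mathfrak{m}I)^{cl}$, it follows that $I\subseteq J^{cl}$. An ideal $J$ is a $cl$-reduction of $I$ if $J\subseteq I\subseteq J^{cl}$; it is a minimal $cl$-reduction of $I$ if it is minimal with respect to inclusion among the $cl$-reductions of $I$. Elements $x_1,\dots,x_n\in R$ are $cl$-independent if $x_i\notin(x_1,\dots,\hat{x_i},\dots,x_n)^{cl}$ for each $1\le i\le n$ (the hat denotes omission). An ideal is strongly $cl$-independent if every minimal set of generators of the ideal is $cl$-independent. *)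

(* Defs.v *)
From mathcomp Require Import all_boot all_algebra.
From mathcomp Require Import boolp classical_sets.

Set Implicit Arguments.
Unset Strict Implicit.
Unset Printing Implicit Defensive.

Import GRing.Theory.

Local Open Scope classical_set_scope.
Local Open Scope ring_scope.

(* Unlike idealr_closed of ring_quotient, this does not exclude the unit
   ideal, and membership need not be decidable. *)
Definition is_ideal (R : comNzRingType) (I : set R) : Prop :=
  [/\ I 0, (forall x y, I x -> I y -> I (x + y))
    & (forall a x, I x -> I (a * x))].

Record ideal (R : comNzRingType) := Ideal {
  ideal_set :> set R;
  idealP : is_ideal ideal_set }.

Lemma ideal_ext (R : comNzRingType) (I J : ideal R) :
  (I : set R) = (J : set R) -> I = J.
Proof.
case: I J => I hI [J hJ] /= e; case: _ / e hJ => hJ.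
by congr Ideal; apply: Prop_irrelevance.
Qed.

Lemma is_ideal_gen (R : comNzRingType) (A : set R) :
  is_ideal (smallest (@is_ideal R) A).
Proof.
split=> [I [[]]//|x y hx hy I hI|a x hx I hI].
- by case: (hI) => -[_ addI _] _; apply: addI; [exact: hx|exact: hy].
- by case: (hI) => -[_ _ mulI] _; apply: mulI; exact: hx.
Qed.

Definition gen (R : comNzRingType) (A : set R) : ideal R :=
  Ideal (is_ideal_gen A).

Lemma is_ideal_add (R : comNzRingType) (I J : ideal R) :
  is_ideal [set a + b | a in I & b in J].
Proof.
case: I J => I [I0 ID IM] [J [J0 JD JM]]; split=> /=.
- by exists 0 => //; exists 0 => //; rewrite addr0.
- move=> _ _ [a Ia [b Jb <-]] [c Ic [d Jd <-]].
  exists (a + c); first exact: ID.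
  by exists (b + d); [exact: JD | rewrite addrACA].
- move=> r _ [a Ia [b Jb <-]]; exists (r * a); first exact: IM.
  by exists (r * b); [exact: JM | rewrite mulrDr].
Qed.

Definition ideal_add (R : comNzRingType) (I J : ideal R) : ideal R :=
  Ideal (is_ideal_add I J).

Definition ideal_mul (R : comNzRingType) (I J : ideal R) : ideal R :=
  gen [set a * b | a in I & b in J].

Definition noetherian (R : comNzRingType) : Prop :=
  forall I : ideal R, exists (n : nat) (x : 'I_n -> R), gen (range x) = I.

Definition maximal_ideal (R : comNzRingType) (M : ideal R) : Prop :=
  (M : set R) <> setT /\
  forall I : ideal R, M `<=` I -> (I : set R) <> setT -> I = M.

Definition local_ring (R : comNzRingType) (m : ideal R) : Prop :=
  maximal_ideal m /\ forall M : ideal R, maximal_ideal M -> M = m.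

Definition closure_operation (R : comNzRingType) (cl : ideal R -> ideal R) :
    Prop :=
  [/\ (forall I : ideal R, I `<=` cl I),
      (forall I : ideal R, cl (cl I) = cl I)
    & (forall I J : ideal R, J `<=` I -> cl J `<=` cl I)].

Definition nakayama_closure (R : comNzRingType) (m : ideal R)
    (cl : ideal R -> ideal R) : Prop :=
  closure_operation cl /\
  forall I J : ideal R,
    J `<=` I -> I `<=` cl (ideal_add J (ideal_mul m I)) -> I `<=` cl J.

Definition cl_reduction (R : comNzRingType) (cl : ideal R -> ideal R)
    (J I : ideal R) : Prop :=
  J `<=` I /\ I `<=` cl J.

Definition minimal_cl_reduction (R : comNzRingType)
    (cl : ideal R -> ideal R) (J I : ideal R) : Prop :=
  cl_reduction cl J I /\
  forall K : ideal R, cl_reduction cl K I -> K `<=` J -> K = J.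

Definition cl_independent (R : comNzRingType) (cl : ideal R -> ideal R)
    (n : nat) (x : 'I_n -> R) : Prop :=
  forall i : 'I_n, ~ ideal_set (cl (gen [set x j | j in [set j | j <> i]])) (x i).

Definition minimal_generating_set (R : comNzRingType) (I : ideal R)
    (A : set R) : Prop :=
  gen A = I /\ forall B : set R, B `<=` A -> gen B = I -> B = A.

(* Over a Noetherian ring a minimal generating set is finite, so enumerating
   it without repetition as x_1, ..., x_n loses nothing. *)
Definition strongly_cl_independent (R : comNzRingType)
    (cl : ideal R -> ideal R) (I : ideal R) : Prop :=
  forall (n : nat) (x : 'I_n -> R),
    injective x -> minimal_generating_set I (range x) -> cl_independent cl x.

(* Main.v *)
Require Import Defs.
From mathcomp Require Import all_boot all_algebra.
From mathcomp Require Import boolp classical_sets.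

(** If [J] is minimal and a generator [x_i] lies in the closure of the ideal
    [K] of the other generators, then [K] is again a reduction of [I], hence
    [K = J], against the minimality of the generating set.

    Conversely let [K] be a reduction of [I] inside [J].  Take [s] in [K] of
    least length with [K <= (s) + mJ], then [t] of least length with
    [(s, t) = J].  These choices make [s, t] a minimal generating set of [J]:
    an element of [t] cannot be dropped, and a relation expressing an element
    of [s] by the others either has a unit coefficient on some element of [t],
    which could then be dropped, or shows that [s] could be shortened.
    Now [J <= cl K <= cl ((s) + mJ)], so [J <= cl (s)] by the Nakayama
    property, and cl-independence forces [t] to be empty; thus
    [J = (s) <= K]. *)

Set Implicit Arguments.
Unset Strict Implicit.
Unset Printing Implicit Defensive.

Import GRing.Theory.

Local Open Scope classical_set_scope.
Local Open Scope ring_scope.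

Lemma exists_min_size (T : Type) (P : seq T -> Prop) :
  (exists s, P s) ->
  exists2 s, P s & forall s', P s' -> (size s <= size s')%N.
Proof.
move=> [s0 Ps0].
have exP : exists n, `[< exists2 s, P s & size s = n >].
  by exists (size s0); apply/asboolP; exists s0.
case: (ex_minnP exP) => n /asboolP[s Ps <-] min_s.
by exists s => // s' Ps'; apply: min_s; apply/asboolP; exists s'.
Qed.

Lemma set_filter_predC1 (T : eqType) (x : T) (s : seq T) :
  [set` filter (predC1 x) s] = [set` s] `\ x.
Proof.
apply/seteqP; split=> y /=.
  by rewrite mem_filter => /andP[/= /eqP nyx ys].
by move=> [ys /eqP nyx]; rewrite mem_filter /= nyx.
Qed.

Lemma size_filter_predC1 (T : eqType) (x : T) (s : seq T) :
  x \in s -> (size (filter (predC1 x) s) < size s)%N.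
Proof.
move=> xs; rewrite size_filter -(count_predC (pred1 x)) -[X in (X < _)%N]add0n.
by rewrite ltn_add2r -has_count has_pred1.
Qed.

(** * Elementary calculus of ideals *)

Section Ideals.
Variable R : comNzRingType.
Implicit Types (I J K m : ideal R) (A B : set R) (s t : seq R).

Lemma ideal0 I : ideal_set I 0. Proof. by case: (idealP I). Qed.

Lemma idealD I x y : ideal_set I x -> ideal_set I y -> ideal_set I (x + y).
Proof. by case: (idealP I) => _ + _; apply. Qed.

Lemma idealMl I a x : ideal_set I x -> ideal_set I (a * x).
Proof. by case: (idealP I) => _ _; apply. Qed.

Lemma idealB I x y : ideal_set I x -> ideal_set I y -> ideal_set I (x - y).
Proof. by move=> Ix Iy; apply: idealD => //; rewrite -mulN1r; apply: idealMl. Qed.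

Lemma sub_gen A : A `<=` gen A.
Proof. by move=> x Ax B [_]; apply. Qed.

Lemma gen_sub A I : A `<=` I -> gen A `<=` I.
Proof. by move=> AI x; apply; split => //; apply: idealP. Qed.

Lemma gen_subset A B : A `<=` B -> gen A `<=` gen B.
Proof. by move=> AB; apply: gen_sub; apply: subset_trans AB (@sub_gen B). Qed.

Lemma ideal_eq I J : I `<=` J -> J `<=` I -> I = J.
Proof. by move=> IJ JI; apply: ideal_ext; apply/seteqP. Qed.

Lemma ideal_addl I J : I `<=` ideal_add I J.
Proof. by move=> x Ix; exists x => //; exists 0; rewrite ?addr0 //; apply: ideal0. Qed.

Lemma ideal_addr I J : J `<=` ideal_add I J.
Proof.
by move=> x Jx; exists 0; [apply: ideal0|exists x; rewrite ?add0r].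
Qed.

Lemma ideal_add_sub I J K : I `<=` K -> J `<=` K -> ideal_add I J `<=` K.
Proof. by move=> IK JK _ [x Ix [y Jy <-]]; apply: idealD; [apply: IK|apply: JK]. Qed.

Lemma mem_ideal_mul I J x y : 
  ideal_set I x -> ideal_set J y -> ideal_set (ideal_mul I J) (x * y).
Proof. by move=> Ix Jy; apply: sub_gen; exists x => //; exists y. Qed.

Lemma ideal_mulS I J K : J `<=` K -> ideal_mul I J `<=` ideal_mul I K.
Proof.
by move=> JK; apply: gen_sub => _ [x Ix [y Jy <-]]; apply: mem_ideal_mul => //; apply: JK.
Qed.

Lemma ideal_mul_subr I J : ideal_mul I J `<=` J.
Proof. by apply: gen_sub => _ [x Ix [y Jy <-]]; apply: idealMl. Qed.

Lemma gen_setU A B : gen (A `|` B) `<=` ideal_add (gen A) (gen B).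
Proof.
apply: gen_sub => x [Ax|Bx]; first by apply: ideal_addl; apply: sub_gen.
by apply: ideal_addr; apply: sub_gen.
Qed.

Lemma is_ideal_principal (x : R) : is_ideal [set a * x | a in setT].
Proof.
split; first by exists 0; rewrite ?mul0r.
  by move=> _ _ [a _ <-] [b _ <-]; exists (a + b); rewrite ?mulrDl.
by move=> b _ [a _ <-]; exists (b * a); rewrite ?mulrA.
Qed.

Lemma gen1P (x y : R) : ideal_set (gen [set x]) y -> exists a, y = a * x.
Proof.
move=> /(@gen_sub _ (Ideal (is_ideal_principal x)))[|a _ <-]; last by exists a.
by move=> _ ->; exists 1; rewrite ?mul1r.
Qed.

(** * Maximal ideals and units of a local ring *)

Lemma proper_ideal_sub_max I : ~ ideal_set I 1 -> exists2 M, maximal_ideal M & I `<=` M.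
Proof.
move=> I1.
(* The union with [I] makes the empty chain harmless. *)
pose P A := is_ideal (A `|` I) /\ ~ (A `|` I) 1.
have [F FP Ftot|A [[hA A1] maxA]] := @Zorn_bigcup R P.
  have up X x : F X -> (X `|` I) x -> (\bigcup_(Y in F) Y `|` I) x.
    by move=> FX [Xx|Ix]; [left; exists X|right].
  split; last by move=> [[X FX X1]|//]; case: (FP X FX) => _; apply; left.
  split; first by right; apply: ideal0.
    move=> x y [[X FX Xx]|Ix] [[Y FY Yy]|Iy]; last by right; apply: idealD.
    - have [XY|YX] := Ftot _ _ FX FY.
        apply: (up Y) => //; case: (FP Y FY) => -[_ + _] _; apply; left => //.
        exact: XY.
      apply: (up X) => //; case: (FP X FX) => -[_ + _] _; apply; left => //.
      exact: YX.
    - by apply: (up X) => //; case: (FP X FX) => -[_ + _] _; apply; [left|right].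
    - by apply: (up Y) => //; case: (FP Y FY) => -[_ + _] _; apply; [right|left].
  move=> a x [[X FX Xx]|Ix]; last by right; apply: idealMl.
  by apply: (up X) => //; case: (FP X FX) => -[_ _ +] _; apply; left.
exists (Ideal hA); last by move=> x Ix; right.
split=> [AT|N AN NT]; first by apply: A1; rewrite (AT : A `|` I = setT).
apply: ideal_eq => // x Nx; left; apply: contrapT => nAx.
(* With [x] in [N] but not in [A], [N] would be a proper ideal strictly larger than [A], against the
   maximality of [A]. *)
have NI : (N : set R) `|` I = N.
  by apply/seteqP; split=> [y [//|Iy]|y Ny]; [apply: AN; right|left].
apply: (maxA N).
  split; last by move=> /(_ x Nx).
  by move=> y Ay; apply: AN; left.
split; rewrite NI; first exact: idealP.
move=> N1; apply: NT; apply/seteqP; split=> // y _.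
by rewrite -[y]mulr1; apply: idealMl.
Qed.

(** If [b] is not a unit, the ideal [(b)] is proper, so it lies in a maximal ideal, which can only
    be [m]. *)
Lemma local_mem_or_unit m (b : R) :
  local_ring m -> ideal_set m b \/ exists c, c * b = 1.
Proof.
move=> [_ uniq_m]; have [/gen1P[c ->]|b1] := pselect (ideal_set (gen [set b]) 1).
  by right; exists c.
left; have [M /uniq_m -> bM] := proper_ideal_sub_max b1.
by apply: bM; apply: sub_gen.
Qed.

(* Writing [y] as a combination of [t], the second case is that of a unit
   coefficient. *)
Lemma gen_mul_or_exchange m t (y : R) : 
  local_ring m -> ideal_set (gen [set` t]) y ->
  ideal_set (ideal_mul m (gen [set` t])) y \/
  exists2 x, x \in t & ideal_set (gen (y |` ([set` t] `\ x))) x.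
Proof.
move=> hm; elim: t y => [|z t IH] y.
  move=> /gen_sub yt; left; apply: yt => x; by rewrite /= in_nil.
have -> : [set` z :: t] = z |` [set` t].
  by apply/seteqP; split=> x /=; rewrite inE => /predU1P.
have [tz|ntz] := pselect (z \in t).
  have -> : z |` [set` t] = [set` t] by apply/setUidPr => _ ->.
  by move=> /IH[|[x xt hx]]; [left|right; exists x; rewrite ?inE ?xt ?orbT].
move=> /gen_setU[_ /gen1P[a ->] [w tw <-]].
(* Here [y = a * z + w] with [w] in [(t)]. If [a] is a unit, this relation is solved for [z]. *)
have [ma|[c ca]] := local_mem_or_unit a hm; last first.
  right; exists z; first exact: mem_head.
  set G := gen _.
  have -> : z = c * (a * z + w - w) by rewrite addrK mulrA ca mul1r.
  apply: idealMl; apply: idealB; first by apply: sub_gen; left.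
  apply: gen_subset tw => x xt; right; split; first by right.
  by move=> /= xz; apply: ntz; rewrite -xz.
(* Since [a] is in [m], the term [a * z] already lies in [m (z, t)], and only [w] is left to
   treat. *)
have [mw|[x xt hx]] := IH _ tw.
  left; apply: idealD; last by apply: ideal_mulS mw; apply: gen_subset => x; right.
  by apply: mem_ideal_mul => //; apply: sub_gen; left.
right; exists x; first by rewrite inE xt orbT.
apply: gen_sub hx => x' [->|[x't nx]]; last by apply: sub_gen; right; split => //; right.
set G := gen _.
(* The exchange found for [w] carries over to [y]: [z] survives the removal of [x], as [x] is in [t]
   and [z] is not. *)
have -> : w = a * z + w - a * z by rewrite addrC addKr.
apply: idealB; first by apply: sub_gen; left.
apply: idealMl; apply: sub_gen; right; split; first by left.
by move=> /= zx; apply: ntz; rewrite zx.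
Qed.

(** * Generators adapted to an inclusion of ideals *)

Lemma noetherian_gen_seq I : noetherian R -> exists s, gen [set` s] = I.
Proof.
move=> /(_ I)[n [x <-]]; exists (codom x); congr gen.
apply/seteqP; split=> [y /codomP[i ->]|_ [i _ <-]]; first by exists i.
exact: codom_f.
Qed.

(* [s] lifts a basis of [(K + mJ)/mJ], and [t] completes it to a lift of a
   basis of [J/mJ]. *)
Lemma adapted_generators m K J :
  noetherian R -> local_ring m -> K `<=` J ->
  exists s t,
    [/\ [set` s] `<=` K, K `<=` ideal_add (gen [set` s]) (ideal_mul m J),
        gen ([set` s] `|` [set` t]) = J,
        (forall x, x \in t -> x \notin s)
      & forall x, ([set` s] `|` [set` t]) x ->
          ~ ideal_set (gen (([set` s] `|` [set` t]) `\ x)) x].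
Proof.
move=> hR hm KJ.
pose P s := [set` s] `<=` K /\ K `<=` ideal_add (gen [set` s]) (ideal_mul m J).
have [|s [sK Ks] min_s] := @exists_min_size _ P.
  have [s sE] := noetherian_gen_seq K hR; exists s; split; rewrite -sE.
    exact: sub_gen.
  exact: ideal_addl.
pose Q t := gen ([set` s] `|` [set` t]) = J.
have [|t Qt min_t] := @exists_min_size _ Q.
  have [t tE] := noetherian_gen_seq J hR; exists t; apply: ideal_eq.
    apply: gen_sub => x [/sK/KJ//|xt]; rewrite -tE; exact: sub_gen.
  by rewrite -tE; apply: gen_subset => x; right.
have tJ : gen [set` t] `<=` J by rewrite -Qt; apply: gen_subset => x; right.
have t_irr x : x \in t -> ~ ideal_set (gen ([set` s] `|` ([set` t] `\ x))) x.
  move=> xt hx; have := size_filter_predC1 xt; rewrite ltnNge; apply/negP.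
  rewrite negbK; apply: min_t; rewrite /Q set_filter_predC1.
  apply: ideal_eq; rewrite -Qt.
    by apply: gen_subset; apply: setUS => y [].
  apply: gen_sub => y [ys|yt]; first by apply: sub_gen; left.
  have [->//|nyx] := pselect (y = x).
  by apply: sub_gen; right.
have st x : x \in t -> x \notin s.
  by move=> xt; apply/negP => xs; apply: (t_irr x xt); apply: sub_gen; left.
exists s, t; split=> // x stx hx.
have [xs|nxs] := pselect (x \in s); last first.
  have xt : x \in t by case: stx.
  by apply: (t_irr x xt); apply: gen_subset hx => y [[ys|yt] nyx]; [left|right].
(* The relation splits as [x = v + y], with [v] generated by the rest of [s] and [y] by [t]. *)
move: hx; rewrite setDUl => /gen_setU[v sv [y ty vyx]].
have {}ty : ideal_set (gen [set` t]) y by apply: gen_subset ty => z [].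
have [my|[z zt hz]] := gen_mul_or_exchange hm ty.
  (* Now [y] lies in [mJ], so [x] can be deleted from [s], against its least length. *)
  have := size_filter_predC1 xs; rewrite ltnNge; apply/negP; rewrite negbK.
  apply: min_s; rewrite /P set_filter_predC1; split; first by move=> z [/sK].
  apply: subset_trans Ks _; apply: ideal_add_sub; last exact: ideal_addr.
  apply: gen_sub => z zs; have [->|nzx] := pselect (z = x).
    by exists v => //; exists y => //; apply: ideal_mulS my.
  by apply: ideal_addl; apply: sub_gen.
(* As [y = x - v] lies in [(s)], the exchange makes [z] redundant beside [s] and the rest of [t]. *)
apply: (t_irr z zt); apply: gen_sub hz => w [->|]; last by move=> ?; apply: sub_gen; right.
have -> : y = x - v by rewrite -vyx addrC addKr.
apply: idealB; first by apply: sub_gen; left.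
by apply: gen_subset sv => u [us _]; left.
Qed.

End Ideals.

Theorem proposition2p3 (R : comNzRingType) (m : ideal R)
    (cl : ideal R -> ideal R) (I J : ideal R)
    (hnoeth : noetherian R) (hlocal : local_ring m)
    (hcl : nakayama_closure m cl) (hJ : cl_reduction cl J I) :
  minimal_cl_reduction cl J I <-> strongly_cl_independent cl J.
Proof.
case: hcl => -[cl_ext cl_idem cl_mono] nak; case: hJ => JI IclJ.
split=> [[_ minJ] n x x_inj [genJ min_x] i clxi|indJ].
  set A := [set x j | j in [set j | j <> i]] in clxi.
  have Ax : A `<=` range x by move=> _ [j _ <-]; exists j.
  have AJ : gen A `<=` J by rewrite -genJ; apply: gen_subset.
  have JA : J `<=` cl (gen A).
    rewrite -genJ; apply: gen_sub => _ [j _ <-].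
    have [->//|nji] := pselect (j = i).
    by apply: cl_ext; apply: sub_gen; exists j.
  have red : cl_reduction cl (gen A) I.
    split; first exact: subset_trans AJ JI.
    apply: subset_trans IclJ _; rewrite -[cl (gen A)]cl_idem.
    exact: cl_mono.
  (* Minimality of [J] gives [gen A = J], hence [A = range x]; injectivity keeps [x i] out of
     [A]. *)
  have : A (x i) by rewrite (min_x A Ax (minJ _ red AJ)); exists i.
  by move=> [j nji /x_inj].
split=> // K [KI IK] KJ; apply: ideal_eq => //.
have [s [t [sK Ks stJ t_s irr]]] := adapted_generators hnoeth hlocal KJ.
case: t => [|z t] in stJ t_s irr *.
  by rewrite -stJ; apply: gen_sub => x [/sK|].
(* Independence concerns injective families, so repetitions are removed before indexing. *)
set u := undup (s ++ z :: t).
have uE : [set` u] = [set` s] `|` [set` z :: t].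
  by apply/seteqP; split=> x /=; rewrite mem_undup mem_cat => /orP.
rewrite -uE in stJ irr.
pose x (i : 'I_(size u)) := nth 0 u i.
have x_inj : injective x.
  move=> i j /eqP; rewrite nth_uniq ?undup_uniq //.
  by move=> /eqP/val_inj.
have xE : range x = [set` u].
  apply/seteqP; split=> [_ [i _ <-]|y /= yu]; first exact: mem_nth.
  have yu' : (index y u < size u)%N by rewrite index_mem.
  by exists (Ordinal yu'); rewrite // /x nth_index.
have min_x : minimal_generating_set J (range x).
  rewrite xE; split=> // B Bu BJ; apply/seteqP; split=> // y uy.
  (* A generating [B] without [y] would express [y] by the other elements of [u]. *)
  apply: contrapT => nBy; apply: (irr y uy).
  have : ideal_set J y by rewrite -stJ; apply: sub_gen.
  rewrite -BJ; apply: gen_subset => w Bw; split; first exact: Bu.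
  by move=> /= wy; apply: nBy; rewrite -wy.
have zu : (index z u < size u)%N.
  by rewrite index_mem mem_undup mem_cat mem_head orbT.
have xz : x (Ordinal zu) = z by rewrite /x nth_index // -index_mem.
case: (indJ _ _ x_inj min_x (Ordinal zu)); rewrite xz.
have Jz : ideal_set J z by rewrite -stJ; apply: sub_gen; rewrite uE; right; apply: mem_head.
have Jcls : J `<=` cl (gen [set` s]).
  apply: nak; first by apply: gen_sub => y /sK/KJ.
  by apply: subset_trans JI (subset_trans IK _); apply: cl_mono.
apply: cl_mono (Jcls z Jz); apply: gen_subset => y ys.
have : [set` u] y by rewrite uE; left.
(* The index of an element of [s] differs from that of [z], because [z] is not in [s]. *)
rewrite -xE => -[i _ xiy]; exists i => // iz.
have /negP := t_s z (mem_head z t); apply.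
by rewrite -xz -iz xiy.
Qed.
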